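(* Let $\mathbb H$ be a Hilbert space with inner product $\langle\cdot,\cdot\rangle_{\mathbb H}$ and corresponding norm $\|\cdot\|_{\mathbb H}$, and let $\Lambda\subseteq\mathbb H$ be a (known) closed and convex set. Let $\theta_0\in\mathbb H$, and suppose there are maps $\hat\theta_n:\{X_i\}_{i=1}^n\to\mathbb H$ such that, for some $r_n\uparrow\infty$, $r_n\{\hat\theta_n-\theta_0\}\stackrel{L}{\to}\mathbb G_0$ in $\mathbb H$, where $\mathbb G_0$ is tight. If $\theta_0\in\Lambda$, then $$r_n\|\hat\theta_n-\Pi_\Lambda\hat\theta_n\|_{\mathbb H}\stackrel{L}{\to}\|\mathbb G_0-\Pi_{T_{\theta_0}}\mathbb G_0\|_{\mathbb H}.$$
   Context: For a closed convex nonempty set $C\subseteq\mathbb H$, $\Pi_C:\mathbb H\to C$ is the metric projection, $\|\theta-\Pi_C\theta\|_{\mathbb H}=\inf_{h\in C}\|\theta-h\|_{\mathbb H}$. The tangent cone of $\Lambda$ at $\theta\in\mathbb H$ is $T_\theta\equiv\overline{\bigcup_{\alpha\ge0}\alpha\{\Lambda-\Pi_\Lambda\theta\}}$, where $\alpha\{\Lambda-\Pi_\Lambda\theta\}=\{\alpha(\lambda-\Pi_\Lambda\theta):\lambda\in\Lambda\}$ and the closure is under $\|\cdot\|_{\mathbb H}$; it is a closed convex set. $\hat\theta_n:\{X_i\}_{i=1}^n\to\mathbb H$ means $\hat\theta_n$ is a (not necessarily measurable) function of the data $\{X_i\}_{i=1}^n$. Convergence in distribution $\stackrel{L}{\to}$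 is in the Hoffman-Jørgensen sense: $Z_n\stackrel{L}{\to}Z$ ($Z$ Borel) means $E^*[f(Z_n)]\to E[f(Z)]$ for all bounded continuous real $f$, where $E^*$ is outer expectation. $\mathbb G_0$ is a Borel random element of $\mathbb H$. *)

(* Defs.v *)
From HB Require Import structures.
From mathcomp Require Import all_boot all_order all_algebra sesquilinear.
From mathcomp Require Import all_classical all_reals all_analysis.
From mathcomp Require Import measurable_realfun.

Set Implicit Arguments.
Unset Strict Implicit.
Unset Printing Implicit Defensive.

Import Order.TTheory GRing.Theory Num.Theory.
Import numFieldNormedType.Exports.

Local Open Scope classical_set_scope.
Local Open Scope ring_scope.

(* A real Hilbert space is a complete normed module whose norm is induced by
   the positive definite symmetric form [dot]. *)
Definition norm_of_dot (R : realType) (H : completeNormedModType R)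
    (dot : {dot H for idfun}) : Prop :=
  forall x : H, `|x| = Num.sqrt (dot x x).

(* The value is [0] when the infimum is not attained, which does not happen
   for a nonempty closed convex subset of a Hilbert space. *)
Definition metric_proj (R : realType) (H : normedModType R) (C : set H)
    (x : H) : H :=
  xget 0 [set y | C y /\ `|x - y| = inf [set `|x - h| | h in C]].

Definition tangent_cone (R : realType) (H : normedModType R) (L : set H)
    (theta : H) : set H :=
  closure (\bigcup_(a in [set a : R | 0 <= a])
    [set a *: (l - metric_proj L theta) | l in L]).

(* The condition [_ +? _] says that the expectation of [U] exists: its positive
   and negative parts do not both have an infinite integral. *)
Definition outer_expectation d (T : measurableType d) (R : realType)
    (P : probability T R) (X : T -> \bar R) : \bar R :=
  ereal_inf [set (\int[P]_w U w)%E | U in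
    [set U : T -> \bar R | [/\ measurable_fun setT U,
      ((\int[P]_w U^\+ w) +? - (\int[P]_w U^\- w))%E &
      forall w, (X w <= U w)%E]]].

Definition borel_map d (T : measurableType d) (E : ptopologicalType)
    (Z : T -> E) : Prop :=
  measurable_fun setT (Z : T -> g_sigma_algebraType (@open E)).

(* Convergence in law in the sense of Hoffmann-Jorgensen: the [Z n] may be
   defined on different probability spaces and need not be measurable. *)
Definition cvg_in_law (R : realType) (E : ptopologicalType)
    (d : nat -> measure_display) (T : forall n, measurableType (d n))
    (P : forall n, probability (T n) R) (Z : forall n, T n -> E)
    (d0 : measure_display) (T0 : measurableType d0)
    (P0 : probability T0 R) (Z0 : T0 -> E) : Prop :=
  borel_map Z0 /\
  forall f : E -> R, continuous f -> bounded_fun f ->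
    outer_expectation (P n) (fun w => (f (Z n w))%:E) @[n --> \oo] -->
    ('E_P0[f \o Z0])%E.

Definition tight_map d (T : measurableType d) (R : realType)
    (P : probability T R) (E : ptopologicalType) (Z : T -> E) : Prop :=
  forall e : R, 0 < e ->
    exists2 K : set E, compact K & ((1 - e)%:E <= P (Z @^-1` K))%E.

(* Main.v *)
(** Since [theta0] lies in [Lambda], the quantity of interest is [g_n (Z_n)] with
    [Z_n = r_n (theta_hat_n - theta0)] and [g_n z] the distance from [z] to
    [r_n (Lambda - theta0)]. By convexity these sets increase along
    [r_n -> +oo] to a dense subset of the tangent cone [T], so that the
    1-Lipschitz functions [g_n] converge pointwise, hence continuously, to the
    distance [g] to [T].

    Let [f] be continuous with [|f| <= M]. By compactness [f \o g_n] is uniformly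
    close to [f \o g] near a compact set [K] carrying most of the law of [G0],
    and elsewhere it is within [2 M] of it. With [phi] a continuous cutoff
    vanishing on [K] and equal to [1] away from [K], [f \o g_n] is thus squeezed
    between the continuous functions [f \o g -+ (e + 2 M phi)]. Only the
    monotonicity of outer expectation is needed to conclude. *)

Require Import Defs.
From HB Require Import structures.
From mathcomp Require Import all_boot all_order all_algebra sesquilinear.
From mathcomp Require Import all_classical all_reals all_analysis.
From mathcomp Require Import measurable_realfun.
From mathcomp Require Import ring lra.

Set Implicit Arguments.
Unset Strict Implicit.
Unset Printing Implicit Defensive.

Import Order.TTheory GRing.Theory Num.Theory.
Import numFieldNormedType.Exports.

Local Open Scope classical_set_scope.
Local Open Scope ring_scope.

(** * Distance to a set in a normed space *)

Definition set_dist (R : realType) (H : normedModType R) (C : set H) (x : H) :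
    R :=
  inf [set `|x - h| | h in C].

Section SetDist.
Context {R : realType} {H : normedModType R}.
Implicit Types (C D : set H) (x y h : H).

Let dist_has_lbound C x : has_lbound [set `|x - h| | h in C].
Proof. by exists 0 => _ [h _ <-]. Qed.

Lemma set_dist_le C x h : C h -> set_dist C x <= `|x - h|.
Proof. by move=> Ch; apply: ge_inf => //; exists h. Qed.

Lemma set_dist_ge C x (m : R) :
  C !=set0 -> (forall h, C h -> m <= `|x - h|) -> m <= set_dist C x.
Proof.
move=> [h Ch] le_m; apply: lb_le_inf; first by exists `|x - h|; exists h.
by move=> _ [h' Ch' <-]; exact: le_m.
Qed.

Lemma set_dist_ge0 C x : C !=set0 -> 0 <= set_dist C x.
Proof. by move=> C0; apply: set_dist_ge. Qed.

Lemma set_dist_ltP C x (m : R) :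
  C !=set0 -> set_dist C x < m -> exists2 h, C h & `|x - h| < m.
Proof.
move=> [h Ch] lt_m.
have hinf : has_inf [set `|x - h| | h in C].
  by split => //; exists `|x - h|; exists h.
have := @inf_adherent _ _ (m - set_dist C x) _ hinf.
rewrite subr_gt0 => /(_ lt_m) [_ [h' Ch' <-] lt_h'].
by exists h' => //; rewrite -(subrKC (set_dist C x) m).
Qed.

Lemma set_dist_mem C x : C x -> set_dist C x = 0.
Proof.
move=> Cx; apply/eqP; rewrite eq_le set_dist_ge0 ?andbT; last by exists x.
by have := set_dist_le x Cx; rewrite subrr normr0.
Qed.

Lemma set_dist_lip C x y :
  C !=set0 -> `|set_dist C x - set_dist C y| <= `|x - y|.
Proof.
move=> C0.
have half u v : set_dist C u <= `|u - v| + set_dist C v.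
  rewrite -lerBlDl; apply: set_dist_ge => // h Ch.
  rewrite lerBlDl (le_trans (set_dist_le u Ch))//.
  by rewrite (le_trans _ (ler_normD _ _))// addrA subrK.
by rewrite ler_norml lerBlDr half andbT lerNl opprB lerBlDr distrC half.
Qed.

Lemma lip1_continuous (f : H -> R) :
  (forall x y, `|f x - f y| <= `|x - y|) -> continuous f.
Proof.
move=> lip x; apply/cvgrPdist_lt => e e0; 
have := nbhsx_ballx x e e0; apply: filterS => y; rewrite -ball_normE.
by apply: le_lt_trans; exact: lip.
Qed.

Lemma set_dist_continuous C : C !=set0 -> continuous (set_dist C).
Proof. by move=> C0; apply: lip1_continuous => x y; exact: set_dist_lip. Qed.

End SetDist.

(** * Existence of best approximations in a Hilbert space *)

Section Projection.
Context {R : realType} {H : completeNormedModType R}.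
Variable dot : {dot H for idfun}.
Hypothesis hilbertH : norm_of_dot dot.
Implicit Types (C : set H) (x y z : H).

Lemma dot_sqr_norm x : dot x x = `|x| ^+ 2.
Proof.
rewrite hilbertH sqr_sqrtr//.
have [->|/neq0_dnorm_gt0/ltW//] := eqVneq x 0.
by rewrite linear0l.
Qed.

Lemma parallelogram_law x y :
  `|x + y| ^+ 2 + `|x - y| ^+ 2 = (`|x| ^+ 2 + `|y| ^+ 2) *+ 2.
Proof.
rewrite -!dot_sqr_norm (hnormD dot) (hnormB dot) /= expr0 mul1r.
by rewrite addrACA subrr addr0 mulr2n.
Qed.

(** The part of convexity that the parallelogram law calls for; it passes easily to closures. *)
Definition midpoint_closed C :=
  forall x y, C x -> C y -> C (2^-1 *: (x + y)).

(** Parallelogram law for [x - z] and [x - y]: their sum is twice the vector from the midpoint of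
    [y] and [z] to [x]. With [d] the distance from [x] to [C], its norm is at least [2 * d], which
    leaves at most [4 * (d + e) ^+ 2 - 4 * d ^+ 2] for the difference. *)
Lemma near_minimizer_dist C x y z (e : R) : midpoint_closed C -> 0 <= e ->
    C y -> C z -> `|x - y| <= set_dist C x + e -> `|x - z| <= set_dist C x + e ->
  `|y - z| ^+ 2 <= 8 * set_dist C x * e + 4 * e ^+ 2.
Proof.
move=> mC e0 Cy Cz xy xz.
have := parallelogram_law (x - z) (x - y).
rewrite (_ : x - z - (x - y) = y - z); last first.
  by rewrite opprB addrC addrA subrK.
rewrite (_ : x - z + (x - y) = 2 *: (x - 2^-1 *: (y + z))); last first.
  rewrite scalerBr scalerA divff// scale1r scaler_nat mulr2n addrACA.
  by rewrite opprD [- z - y]addrC.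
have d0 : 0 <= set_dist C x by apply: set_dist_ge0; exists y.
have := set_dist_le x (mC _ _ Cy Cz).
rewrite normrZ ger0_norm// exprMn mulr2n.
move: xy xz (normr_ge0 (x - y)) (normr_ge0 (x - z)) d0.
move: (set_dist C x) `|x - y| `|x - z| `|y - z| `|x - _ *: _| => d a b c m.
move=> ad bd a0 b0 d0 dm Heq.
have m0 : 0 <= m by exact: le_trans d0 dm.
have : d ^+ 2 <= m ^+ 2 by rewrite ler_sqr ?nnegrE.
have : a ^+ 2 <= (d + e) ^+ 2 by rewrite ler_sqr ?nnegrE// addr_ge0.
have : b ^+ 2 <= (d + e) ^+ 2 by rewrite ler_sqr ?nnegrE// addr_ge0.
nra.
Qed.

(** The sets [B e] of near minimizers generate a Cauchy filter by [near_minimizer_dist]; by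
    completeness it has a limit, which is a minimizer. *)
Lemma set_dist_attained C x : C !=set0 -> closed C -> midpoint_closed C ->
  exists2 y, C y & `|x - y| = set_dist C x.
Proof.
move=> C0 clC mC.
pose B (e : R) := [set y | C y /\ `|x - y| <= set_dist C x + e].
pose F := filter_from [set e : R | 0 < e] B.
have B_ne e : 0 < e -> B e !=set0.
  move=> e0; have [|y Cy /ltW xy] := @set_dist_ltP _ _ C x (set_dist C x + e) C0.
    by rewrite ltrDl.
  by exists y.
have FF : Filter F.
  apply: filter_from_filter; first by exists 1 => /=.
  move=> i j i0 j0; exists (Num.min i j); first by rewrite /= lt_min i0.
  move=> y [Cy xy]; split; split=> //; rewrite (le_trans xy)// lerD2l.
    by rewrite ge_min lexx.
  by rewrite ge_min lexx orbT.
have PF : ProperFilter F by apply: filter_from_proper.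
have : cvg F.
  apply: cauchy_cvg; apply: cauchy_exP => e e0.
  have d0 := set_dist_ge0 x C0.
  (* Since [k <= 1], the bound [8 * d * k + 4 * k ^+ 2] is at most [k * (8 * d + 4)], hence at most
     [e ^+ 2 / 2]. *)
  pose k := Num.min 1 (e ^+ 2 / (2 * (8 * set_dist C x + 4))).
  have k0 : 0 < k.
    rewrite lt_min ltr01 divr_gt0 ?exprn_gt0// mulr_gt0//; lra.
  have [y [Cy xy]] := B_ne _ k0.
  exists y; exists k => // z [Cz xz]; rewrite -ball_normE /=.
  rewrite -ltr_sqr ?nnegrE ?(ltW e0)//.
  have := near_minimizer_dist mC (ltW k0) Cy Cz xy xz.
  have k1 : k <= 1 by rewrite ge_min lexx.
  have ke : k * (2 * (8 * set_dist C x + 4)) <= e ^+ 2.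
    rewrite -ler_pdivlMr ?ge_min ?lexx ?orbT//; lra.
  have e2 : 0 < e ^+ 2 by rewrite exprn_gt0.
  move/le_lt_trans; apply; nra.
move=> Fl; have Cl : C (lim F).
  apply: (closed_cvg (F := F) (u_ := id) C clC) => //.
  by exists 1 => //= y [].
exists (lim F) => //; apply/eqP; rewrite eq_le set_dist_le// andbT.
apply/ler_addgt0Pr => e e0.
apply: (closed_cvg (F := F) (u_ := fun y => `|x - y|)
    [set t | t <= set_dist C x + e]).
- exact: closed_le.
- by exists e => //= y [].
- by apply: cvg_norm; apply: cvgB; [exact: cvg_cst|exact: Fl].
Qed.

(** A minimizer exists, so the choice in [metric_proj] does not fall back on the default [0]. *)
Lemma metric_projP C x : C !=set0 -> closed C -> midpoint_closed C ->
  C (metric_proj C x) /\ `|x - metric_proj C x| = set_dist C x.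
Proof.
move=> C0 clC mC; have [y Cy xy] := set_dist_attained x C0 clC mC.
exact: (@xgetI _ 0 [set y | C y /\ `|x - y| = set_dist C x] y).
Qed.

End Projection.

(** * The tangent cone as a limit of rescaled copies of the set *)

Section TangentCone.
Context {R : realType} {H : completeNormedModType R}.
Implicit Types (C L : set H) (x y z theta : H).

(** A point of [C] is at distance 0 from [C], and it is the only point at distance 0 from itself. *)
Lemma metric_proj_id C x : C x -> metric_proj C x = x.
Proof.
move=> Cx; have d0 := set_dist_mem Cx.
have [|_] := @xgetI _ 0 [set y | C y /\ `|x - y| = set_dist C x] x.
  by rewrite /= subrr normr0 d0.
by rewrite -/(metric_proj C x) d0 => /eqP; rewrite normr_eq0 subr_eq0 => /eqP.
Qed.

Lemma convex_setE L x y (t : R) : convex_set L -> 0 <= t -> t <= 1 ->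
  L x -> L y -> L (t *: x + (1 - t) *: y).
Proof.
move=> cL t0 t1 Lx Ly; apply: set_mem; apply: (cL x y (Itv01 t0 t1)); exact: mem_set.
Qed.

Lemma convex_midpoint_closed L : convex_set L -> midpoint_closed L.
Proof.
move=> cL x y Lx Ly; rewrite scalerDr.
have -> : 2^-1 *: y = (1 - 2^-1 : R) *: y by congr (_ *: _); lra.
apply: convex_setE => //; lra.
Qed.

Lemma closure_normP C x :
  closure C x <-> forall e : R, 0 < e -> exists2 y, C y & `|x - y| < e.
Proof.
split=> [clx e e0|approx B /nbhs_ballP[e /= e0 eB]].
  have [y [Cy]] := clx _ (nbhsx_ballx x e e0).
  by rewrite -ball_normE => ?; exists y.
have [y Cy xy] := approx _ e0; exists y; split=> //.
by apply: eB; rewrite -ball_normE.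
Qed.

Lemma closure_midpoint_closed C :
  midpoint_closed C -> midpoint_closed (closure C).
Proof.
move=> mC x y /closure_normP clx /closure_normP cly.
apply/closure_normP => e e0.
have [x' Cx' xx'] := clx _ e0; have [y' Cy' yy'] := cly _ e0.
exists (2^-1 *: (x' + y')); first exact: mC.
rewrite -scalerBr opprD addrACA normrZ ger0_norm ?invr_ge0//.
have := ler_normD (x - x') (y - y'); lra.
Qed.

Definition feasible_cone L theta : set H :=
  \bigcup_(a in [set a : R | 0 <= a]) [set a *: (l - theta) | l in L].

Lemma tangent_coneE L theta :
  L theta -> tangent_cone L theta = closure (feasible_cone L theta).
Proof. by move=> Lt; rewrite /tangent_cone metric_proj_id. Qed.

Lemma feasible_cone_scale L theta z (r : R) : 0 < r ->
  L (theta + r^-1 *: z) -> feasible_cone L theta z.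
Proof.
move=> r0 Lz; exists r; first exact: ltW.
exists (theta + r^-1 *: z) => //.
by rewrite addrC addKr scalerA divff ?gt_eqF// scale1r.
Qed.

(* Convexity makes [r *: (L - theta)] increase with [r] when [theta] is in [L]. *)
Lemma feasible_coneP L theta z : convex_set L -> L theta ->
  feasible_cone L theta z ->
  exists a : R, forall r : R, 0 < r -> a <= r -> L (theta + r^-1 *: z).
Proof.
move=> cL Lt [a /= a0 [l Ll <-]]; exists a => r r0 ar.
(* For [a <= r] the point is a convex combination of [l] and [theta], with weight [r^-1 * a] on
   [l]. *)
have -> : theta + r^-1 *: (a *: (l - theta))
    = (r^-1 * a) *: l + (1 - r^-1 * a) *: theta.
  rewrite scalerA scalerBr scalerBl scale1r addrCA; congr (_ + _).
apply: convex_setE => //; first by rewrite mulr_ge0// invr_ge0 ltW.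
by rewrite mulrC ler_pdivrMr// mul1r.
Qed.

(** Beyond both thresholds of [feasible_coneP], the two points lie in one convex set
    [r *: (L - theta)]. *)
Lemma feasible_cone_midpoint_closed L theta : convex_set L -> L theta ->
  midpoint_closed (feasible_cone L theta).
Proof.
move=> cL Lt x y /(feasible_coneP cL Lt)[a ax] /(feasible_coneP cL Lt)[b bY].
(* The thresholds [a] and [b] carry no sign information; the 1 makes [r] positive. *)
pose r := Num.max 1 (Num.max a b).
have r0 : 0 < r by rewrite lt_max ltr01.
have Lx : L (theta + r^-1 *: x) by apply: ax => //; rewrite !le_max lexx orbT.
have Ly : L (theta + r^-1 *: y) by apply: bY => //; rewrite !le_max lexx !orbT.
apply: (feasible_cone_scale r0).
have -> : theta + r^-1 *: (2^-1 *: (x + y))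
    = 2^-1 *: ((theta + r^-1 *: x) + (theta + r^-1 *: y)).
  rewrite addrACA -[in RHS]scalerDr [RHS]scalerDr !scalerA mulrC.
  by rewrite [in RHS]scalerDr -scalerDl (_ : 2^-1 + 2^-1 = 1) ?scale1r//; lra.
exact: convex_midpoint_closed.
Qed.

Lemma tangent_cone_neq0 L theta : L theta -> tangent_cone L theta !=set0.
Proof.
move=> Lt; exists 0; rewrite tangent_coneE//; apply: subset_closure.
by exists 0 => //=; exists theta => //; rewrite scale0r.
Qed.

(** For [0 < r], this is the distance from [z] to [r *: (L - theta)]. *)
Definition scaled_dist L theta (r : R) z : R :=
  r * set_dist L (theta + r^-1 *: z).

Lemma scaled_dist_lip L theta (r : R) x y : L !=set0 -> 0 < r ->
  `|scaled_dist L theta r x - scaled_dist L theta r y| <= `|x - y|.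
Proof.
move=> L0 r0; rewrite /scaled_dist -mulrBr normrM (gtr0_norm r0).
rewrite -ler_pdivlMl// (le_trans (set_dist_lip _ _ L0))//.
by rewrite opprD addrACA subrr add0r -scalerBr normrZ gtr0_norm ?invr_gt0.
Qed.

Lemma scaled_dist_le L theta (r : R) x z : 0 < r -> L (theta + r^-1 *: x) ->
  scaled_dist L theta r z <= `|z - x|.
Proof.
move=> r0 Lx; rewrite -ler_pdivlMl// (le_trans (set_dist_le _ Lx))//.
by rewrite opprD addrACA subrr add0r -scalerBr normrZ gtr0_norm ?invr_gt0.
Qed.

(** The set [r *: (L - theta)] is contained in the tangent cone, and the distance to a smaller set
    is larger. *)
Lemma scaled_dist_ge L theta (r : R) z : L theta -> 0 < r ->
  set_dist (tangent_cone L theta) z <= scaled_dist L theta r z.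
Proof.
move=> Lt r0; rewrite -ler_pdivrMl//; apply: set_dist_ge; first by exists theta.
move=> h Lh; rewrite ler_pdivrMl// -[X in X * _](gtr0_norm r0) -normrZ.
rewrite scalerBr scalerDr scalerA divff ?gt_eqF// scale1r.
rewrite (_ : _ - _ = z - r *: (h - theta)); last first.
  by rewrite scalerBr opprB addrA [z + _]addrC.
apply: set_dist_le; rewrite tangent_coneE//; apply: subset_closure.
by exists r; [exact: ltW|exists h].
Qed.

(* All the [scaled_dist L theta (r n)] are 1-Lipschitz, so that their pointwise
   convergence is a continuous convergence. *)
Lemma cvg_scaled_dist L theta (r : nat -> R) z : convex_set L -> L theta ->
    r n @[n --> \oo] --> +oo ->
  scaled_dist L theta (r p.1) p.2 @[p --> (\oo, nbhs z)] -->
    set_dist (tangent_cone L theta) z.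
Proof.
move=> cL Lt roo; set d := set_dist _ z.
apply/cvgrPdist_lt => e e0.
have T0 := tangent_cone_neq0 Lt.
have e4 : 0 < e / 4 by rewrite divr_gt0.
(* A near minimizer [t] in the cone is replaced by a nearby [x] before closure, which lies in
   [r *: (L - theta)] for all large [r]. The upper bound costs three errors [e / 4]: from [t], from
   [x] and from moving [z]. *)
have [t Tt zt] : exists2 t, tangent_cone L theta t & `|z - t| < d + e / 4.
  by apply: set_dist_ltP => //; rewrite ltrDl.
move: Tt; rewrite tangent_coneE// => /closure_normP/(_ _ e4)[x Kx tx].
have [a Lx] := feasible_coneP cL Lt Kx.
have rpos : \forall p \near (\oo, nbhs z), 0 < r p.1.
  exact: (@cvg_fst _ _ \oo (nbhs z) _ _ (cvgry_gt roo 0)).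
have rlarge : \forall p \near (\oo, nbhs z), a <= r p.1.
  exact: (@cvg_fst _ _ \oo (nbhs z) _ _ (cvgry_ge roo a)).
have znear : \forall p \near (\oo, nbhs z), ball z (e / 4) p.2.
  exact: (@cvg_snd _ _ \oo (nbhs z) _ _ (nbhsx_ballx z _ e4)).
near=> p.
have r0 : 0 < r p.1 by near: p.
have ar : a <= r p.1 by near: p.
have zp : `|z - p.2| < e / 4.
  have : ball z (e / 4) p.2 by near: p.
  by rewrite -ball_normE.
have dle := scaled_dist_ge p.2 Lt r0.
have dz := set_dist_lip z p.2 T0.
have := scaled_dist_le p.2 r0 (Lx _ r0 ar).
have := ler_distD z p.2 x; have := ler_distD t z x.
move: dz; rewrite -/d ler_norml ltr_norml => /andP[].
rewrite (distrC p.2 z); lra.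
Unshelve. all: by end_near. Qed.

Variable dot : {dot H for idfun}.
Hypothesis hilbertH : norm_of_dot dot.

Lemma norm_sub_metric_proj_convex L theta x :
  convex_set L -> closed L -> L theta ->
  `|x - metric_proj L x| = set_dist L x.
Proof.
move=> cL clL Lt; apply: (metric_projP hilbertH _ _ clL _).2.
  by exists theta.
exact: convex_midpoint_closed.
Qed.

Lemma norm_sub_metric_proj_tangent L theta x : convex_set L -> L theta ->
  `|x - metric_proj (tangent_cone L theta) x|
    = set_dist (tangent_cone L theta) x.
Proof.
move=> cL Lt; apply: (metric_projP hilbertH _ _ _ _).2.
- exact: tangent_cone_neq0.
- exact: closed_closure.
- rewrite tangent_coneE//; apply: closure_midpoint_closed.
  exact: feasible_cone_midpoint_closed.
Qed.

End TangentCone.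

(** * Borel maps and their composition with continuous functions *)

Section BorelMaps.
Context d (T : measurableType d).

Lemma borel_map_open (E : ptopologicalType) (Z : T -> E) (A : set E) :
  borel_map Z -> open A -> measurable (Z @^-1` A).
Proof.
move=> mZ oA; rewrite -[X in measurable X]setTI.
by apply: mZ => //; exact: sub_sigma_algebra.
Qed.

Lemma borel_map_closed (E : ptopologicalType) (Z : T -> E) (A : set E) :
  borel_map Z -> closed A -> measurable (Z @^-1` A).
Proof.
move=> mZ cA; rewrite -[A]setCK preimage_setC; apply: measurableC.
exact: (borel_map_open mZ (closed_openC cA)).
Qed.

Lemma borel_map_comp (E F : ptopologicalType) (Z : T -> E) (g : E -> F) :
  borel_map Z -> continuous g -> borel_map (g \o Z).
Proof.
move=> mZ /continuousP cg.
apply: (@measurability _ _ _ (g_sigma_algebraType (@open F)) _ _ (@open F)) => //.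
move=> _ [A oA <-]; rewrite setTI comp_preimage.
exact: (borel_map_open mZ (cg _ oA)).
Qed.

Lemma borel_map_measurable (R : realType) (E : ptopologicalType) (Z : T -> E)
  (g : E -> R) : borel_map Z -> continuous g -> measurable_fun setT (g \o Z).
Proof.
move=> mZ /continuousP cg; apply: (measurability _ (RGenOpens.measurableE R)).
move=> _ [_ [a [b ->] <-]]; rewrite setTI comp_preimage.
exact/(borel_map_open mZ)/cg/interval_open.
Qed.

Lemma borel_map_Lfun1 (R : realType) (P : probability T R)
    (E : ptopologicalType) (Z : T -> E) (g : E -> R) :
  borel_map Z -> continuous g -> bounded_fun g -> g \o Z \in Lfun P 1.
Proof.
move=> mZ cg bg; apply/Lfun1_integrable.
apply: measurable_bounded_integrable => //.
- by rewrite (le_lt_trans (probability_le1 _ _))// ltry.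
- exact: borel_map_measurable.
- by case: bg => M [Mreal bM]; exists M; split=> // x Mx w _; exact: bM.
Qed.

End BorelMaps.

(** * Monotone outer expectation, squeezing, and uniform closeness near compact sets *)

Lemma le_outer_expectation d (T : measurableType d) (R : realType)
    (P : probability T R) (X Y : T -> \bar R) :
  (forall w, X w <= Y w)%E ->
  (outer_expectation P X <= outer_expectation P Y)%E.
Proof.
move=> XY; apply: ereal_inf_le_tmp => _ [U [mU iU YU] <-].
by exists U => //; split=> // w; exact: le_trans (XY w) (YU w).
Qed.

Lemma cvge_squeeze_bounds (R : realType) (u : nat -> \bar R) (l : R) :
  (forall e : R, 0 < e ->
    \forall n \near \oo, ((l - e)%:E <= u n <= (l + e)%:E)%E) ->
  u n @[n --> \oo] --> l%:E.
Proof.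
move=> ul.
have ufin e n : ((l - e)%:E <= u n <= (l + e)%:E)%E -> u n \is a fin_num.
  move=> /andP[lo hi].
  by rewrite fin_numElt (lt_le_trans _ lo) ?ltNyr// (le_lt_trans hi) ?ltry.
apply/fine_cvgP; split.
  by apply: filterS (ul 1 ltr01) => n; exact: ufin.
apply/cvgrPdist_le => e /ul; apply: filterS => n /[dup] /ufin un /=.
rewrite -{1 2}(fineK un) !lee_fin => /andP[lo hi].
by rewrite ler_norml; apply/andP; split; lra.
Qed.

(* [P (n, e) x] of the near-covering form of compactness says that [u n] and [v]
   are close on the whole ball of radius [e] around [x]. *)
Lemma continuous_cvg_near_compact (R : realType) (E : normedModType R)
    (u : nat -> E -> R) (v : E -> R) (K : set E) (e : R) :
    continuous v ->
    (forall x, u p.1 p.2 @[p --> (\oo, nbhs x)] --> v x) ->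
    compact K -> 0 < e ->
  exists2 delta : R, 0 < delta & \forall n \near \oo,
    forall x z, K x -> ball x delta z -> `|u n z - v z| <= e.
Proof.
move=> cv uv /compact_near_coveringP cK e0.
pose Q (i : nat * R) x := forall z, ball x i.2 z -> `|u i.1 z - v z| <= e.
have e2 : 0 < e / 2 by rewrite divr_gt0.
(* The parameter is a pair of an index tending to infinity and a radius tending to 0 from the
   right. *)
have [|[A B] /= [ooA B0] AB] := cK (nat * R)%type (filter_prod \oo 0^'+) Q _.
  move=> x Kx; have /cvgrPdist_lt/(_ _ e2)[[A U] /= [ooA xU] AU] := uv x.
  have /cvgrPdist_lt/(_ _ e2) xV := cv x.
  have /nbhs_ballP[rho /= rho0 rhoUV] :
      nbhs x (U `&` [set t | `|v x - v t| < e / 2]) by exact: filterI.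
  (* Halving [rho] keeps a ball of radius at most [rho / 2] around a point of [ball x (rho / 2)]
     inside [ball x rho], where [u n] and [v] are both within [e / 2] of [v x]. *)
  exists (ball x (rho / 2), A `*` [set t : R | t <= rho / 2]) => /=.
    split; first by apply: nbhsx_ballx; rewrite divr_gt0.
    exists (A, [set t : R | t <= rho / 2]) => //; split=> //=.
    by apply: nbhs_right_le; rewrite divr_gt0.
  move=> [y [n t]] /= [xy [An trho]] z yz.
  have : ball x rho z.
    rewrite [rho]splitr; apply: ball_triangle xy _.
    exact: le_ball trho _ yz.
  move=> /rhoUV[Uz xvz]; have := AU (n, z) (conj An Uz) => /= xuz.
  rewrite (le_trans (ler_distD (v x) _ _))// distrC.
  by rewrite [e]splitr lerD ?ltW.
have [delta [delta0 Bdelta]] : exists delta : R, 0 < delta /\ B delta.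
  apply: (@filter_ex _ (0^'+ : set_system R)).
  by apply: filterI => //; exact: nbhs_right_gt.
exists delta => //; apply: filterS ooA => n An x z Kx.
exact: (AB (n, delta)).
Qed.

Lemma bounded_funP (T : Type) (R : realFieldType) (f : T -> R) :
  bounded_fun f <-> exists2 M : R, 0 < M & forall x, `|f x| <= M.
Proof.
split=> [/pinfty_ex_gt0[M M0 fM]|[M M0 fM]].
  by exists M => // x; exact: fM.
by exists M; split=> [|N /ltW MN x _]; [exact: num_real|exact: le_trans MN].
Qed.

Lemma expectation_affine d (T : measurableType d) (R : realType)
    (P : probability T R) (X Y : T -> R) (a b : R) :
    X \in Lfun P 1 -> Y \in Lfun P 1 ->
  ('E_P[(fun w => X w + (a + b * Y w))%R]
    = 'E_P[X] + (a%:E + b%:E * 'E_P[Y]))%E.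
Proof.
move=> LX LY.
have -> : (fun w => X w + (a + b * Y w))%R = (X \+ (cst a \+ b \o* Y))%R.
  by apply/funext => w /=; rewrite mulrC.
have LbY : (b \o* Y)%R \in Lfun P 1 by exact: Lfun_scale.
have La : (cst a : T -> R) \in Lfun P 1 by exact: Lfun_cst.
rewrite expectationD ?rpredD// expectationD// expectation_cst.
by rewrite expectationZl.
Qed.

(** * A continuous cutoff away from a set *)

Section DistCutoff.
Context {R : realType} {E : normedModType R}.
Variables (K : set E) (delta : R).
Hypotheses (K0 : K !=set0) (delta0 : 0 < delta).

Definition dist_cutoff (z : E) : R := Num.min 1 (delta^-1 * set_dist K z).

Lemma dist_cutoff_itv z : 0 <= dist_cutoff z <= 1.
Proof.
rewrite /dist_cutoff le_min ler01 ge_min lexx /= andbT.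
by rewrite mulr_ge0 ?set_dist_ge0// invr_ge0 ltW.
Qed.

Lemma dist_cutoff_continuous : continuous dist_cutoff.
Proof.
apply: (@min_fun_continuous _ E R (cst 1) (fun z => delta^-1 * set_dist K z)).
  exact: cst_continuous.
move=> z; apply: cvgM; first exact: cvg_cst.
exact: set_dist_continuous.
Qed.

Lemma dist_cutoff_mem z : K z -> dist_cutoff z = 0.
Proof. by move=> Kz; rewrite /dist_cutoff set_dist_mem// mulr0 min_r. Qed.

Lemma dist_cutoff_lt1 z : dist_cutoff z < 1 -> exists2 x, K x & ball x delta z.
Proof.
rewrite /dist_cutoff gt_min ltxx /= ltr_pdivrMl// mulr1.
move=> /(set_dist_ltP K0)[x Kx zx]; exists x => //.
by rewrite -ball_normE /ball_ /= distrC.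
Qed.

(** The cutoff is dominated by the indicator of the complement of [K], whose probability is at most
    [e]. *)
Lemma expectation_dist_cutoff d (T : measurableType d) (P : probability T R)
    (Z : T -> E) (e : R) : borel_map Z -> closed K ->
  ((1 - e)%:E <= P (Z @^-1` K))%E -> ('E_P[dist_cutoff \o Z] <= e%:E)%E.
Proof.
move=> mZ cK PK; have mK := borel_map_closed mZ cK.
apply: (@le_trans _ _ (P (~` (Z @^-1` K)))).
  rewrite -expectation_indic; last exact: measurableC.
  apply: expectation_le.
  - exact: borel_map_measurable dist_cutoff_continuous.
  - by apply: measurable_indic; exact: measurableC.
  - by move=> w; have /andP[] := dist_cutoff_itv (Z w).
  - by move=> w; rewrite indicE.
  apply: aeW => w /=; rewrite indicE.
  have [Kw|nKw] := pselect (K (Z w)); first by rewrite dist_cutoff_mem.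
  by rewrite mem_set//; have /andP[] := dist_cutoff_itv (Z w).
rewrite probability_setC//; move: PK.
by rewrite -(fineK (fin_num_measure P _ mK)) !lee_fin; lra.
Qed.

End DistCutoff.

(** * Extended continuous mapping theorem with a tight limit *)

Lemma cvg_in_law_continuous_mapping (R : realType) (E : normedModType R)
    (F : ptopologicalType) (d : nat -> measure_display)
    (T : forall n, measurableType (d n)) (P : forall n, probability (T n) R)
    (Z : forall n, T n -> E) (d0 : measure_display) (T0 : measurableType d0)
    (P0 : probability T0 R) (Z0 : T0 -> E) (u : nat -> E -> F) (v : E -> F) :
    cvg_in_law P Z P0 Z0 -> tight_map P0 Z0 -> continuous v ->
    (forall x, u p.1 p.2 @[p --> (\oo, nbhs x)] --> v x) ->
  cvg_in_law P (fun n w => u n (Z n w)) P0 (v \o Z0).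
Proof.
move=> [mZ0 ZZ0] tZ0 cv uv; split; first exact: borel_map_comp.
move=> f cf bf; have /bounded_funP[M M0 fM] := bf.
have ck : continuous (f \o v).
  by move=> x; apply: continuous_comp; [exact: cv|exact: cf].
have uk x : (f \o u p.1) p.2 @[p --> (\oo, nbhs x)] --> (f \o v) x.
  by apply: cvg_comp (uv x) _; exact: cf.
have bk : bounded_fun (f \o v).
  by apply/bounded_funP; exists M => // x; exact: fM.
have LkZ0 := borel_map_Lfun1 P0 mZ0 ck bk.
have kE := fineK (expectation_fin_num LkZ0); rewrite -[X in _ --> X]kE.
apply: cvge_squeeze_bounds => e e0.
have e3 : 0 < e / 3 by rewrite divr_gt0.
(* The bound [1 / 2] gives [K] positive probability, so that [K] is nonempty; the other bound makes
   [2 * M * eps] at most [e / 3]. *)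
pose eps := Num.min (1 / 2) (e / 3 / (2 * M)).
have eps0 : 0 < eps by rewrite lt_min !divr_gt0// mulr_gt0.
have [K cK PK] := tZ0 _ eps0.
have K0 : K !=set0.
  apply/set0P/eqP => K0; move: PK; rewrite K0 preimage_set0 measure0 lee_fin.
  have : eps <= 1 / 2 by rewrite ge_min lexx.
  lra.
have [delta delta0 near_u] := 
  @continuous_cvg_near_compact _ _ (fun n => f \o u n) _ _ _ ck uk cK e3.
pose phi := dist_cutoff K delta.
have cphi : continuous phi by exact: dist_cutoff_continuous.
have phi01 z : 0 <= phi z <= 1 by exact: dist_cutoff_itv.
have bphi : bounded_fun phi.
  apply/bounded_funP; exists 1 => // z.
  by have /andP[? ?] := phi01 z; rewrite ger0_norm.
have LphiZ0 := borel_map_Lfun1 P0 mZ0 cphi bphi.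
have Ephi_fin := fineK (expectation_fin_num LphiZ0).
have Ephi : 2 * M * fine ('E_P0[phi \o Z0]) <= e / 3.
  have : ('E_P0[phi \o Z0] <= eps%:E)%E.
    apply: expectation_dist_cutoff => //.
    exact: compact_closed (@norm_hausdorff _ _) cK.
  rewrite -Ephi_fin lee_fin mulrC -ler_pdivlMr ?mulr_gt0// => /le_trans; apply.
  by rewrite ge_min lexx orbT.
have Ephi0 : 0 <= fine ('E_P0[phi \o Z0]).
  by apply: fine_ge0; apply: expectation_ge0 => w; have /andP[] := phi01 (Z0 w).
(* Where [phi z < 1], the point is within [delta] of [K] and uniform closeness applies; elsewhere
   [phi z = 1] and the term [2 * M] suffices. *)
have bound_uk n z : (forall x z, K x -> ball x delta z ->
    `|(f \o u n) z - (f \o v) z| <= e / 3) ->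
    `|f (u n z) - f (v z)| <= e / 3 + 2 * M * phi z.
  move=> near_uk; have /andP[phi0 _] := phi01 z.
  have [/(dist_cutoff_lt1 K0 delta0)[x Kx xz]|phi1] := ltP (phi z) 1.
    by rewrite (le_trans (near_uk _ _ Kx xz))// lerDl mulr_ge0// mulr_ge0// ltW.
  rewrite (le_trans (ler_normB _ _))//.
  have := fM (u n z); have := fM (v z); nra.
(* The values [s = 1] and [s = -1] give the upper and lower envelopes. They are independent of [n],
   so the assumed convergence in law applies to them. *)
pose h (s z : _) := f (v z) + (s * (e / 3) + s * (2 * M) * phi z).
have ch s : continuous (h s).
  move=> z; apply: cvgD; first exact: ck.
  apply: cvgD; first exact: cvg_cst.
  by apply: cvgM; [exact: cvg_cst|exact: cphi].
have bh s : bounded_fun (h s).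
  apply/bounded_funP; exists (M + (`|s| * (e / 3) + `|s| * (2 * M))).
    by rewrite ltr_pwDl// addr_ge0// mulr_ge0// ?ltW// mulr_gt0.
  move=> z; rewrite (le_trans (ler_normD _ _))// lerD//.
  rewrite (le_trans (ler_normD _ _))// lerD//.
    by rewrite normrM (gtr0_norm e3).
  have /andP[phi0 phi1] := phi01 z.
  rewrite !normrM (gtr0_norm M0) (ger0_norm phi0) normr_nat.
  by rewrite ler_piMr// mulr_ge0// mulr_ge0// ltW.
have Eh s : 'E_P0[h s \o Z0]%E = (fine ('E_P0[f \o v \o Z0])
    + (s * (e / 3) + s * (2 * M) * fine ('E_P0[phi \o Z0])))%:E.
  by rewrite [LHS]expectation_affine// -kE -Ephi_fin.
have near_h s : \forall n \near \oo, exists2 x : R,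
    outer_expectation (P n) (fun w => (h s (Z n w))%:E) = x%:E &
    `|fine ('E_P0[f \o v \o Z0]) + (s * (e / 3)
      + s * (2 * M) * fine ('E_P0[phi \o Z0])) - x| < e / 3.
  have := ZZ0 (h s) (ch s) (bh s).
  rewrite Eh => /fine_cvgP[hfin /cvgrPdist_lt/(_ _ e3)].
  apply: filterS2 hfin => n /fineK hn lt_n.
  by exists (fine (outer_expectation (P n) (fun w => (h s (Z n w))%:E))).
near=> n.
have ukn w : `|f (u n (Z n w)) - f (v (Z n w))| <= e / 3 + 2 * M * phi (Z n w).
  by apply: bound_uk; near: n.
have [hi hiE hi_lt] : exists2 x : R,
    outer_expectation (P n) (fun w => (h 1 (Z n w))%:E) = x%:E &
    `|fine ('E_P0[f \o v \o Z0]) + (1 * (e / 3)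
      + 1 * (2 * M) * fine ('E_P0[phi \o Z0])) - x| < e / 3.
  by near: n; exact: near_h.
have [lo loE lo_lt] : exists2 x : R,
    outer_expectation (P n) (fun w => (h (-1) (Z n w))%:E) = x%:E &
    `|fine ('E_P0[f \o v \o Z0]) + (-1 * (e / 3)
      + -1 * (2 * M) * fine ('E_P0[phi \o Z0])) - x| < e / 3.
  by near: n; exact: near_h.
(* Each side spends [e / 3] on uniform closeness, [e / 3] on the cutoff and [e / 3] on the
   convergence for [h]. *)
apply/andP; split.
  apply: (@le_trans _ _ lo%:E).
    by rewrite lee_fin; move: lo_lt; rewrite ltr_norml => /andP[]; lra.
  rewrite -loE; apply: le_outer_expectation => w; rewrite lee_fin /h.
  by have := ukn w; rewrite ler_norml => /andP[]; lra.
apply: (@le_trans _ _ hi%:E); last first.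
  by rewrite lee_fin; move: hi_lt; rewrite ltr_norml => /andP[]; lra.
rewrite -hiE; apply: le_outer_expectation => w; rewrite lee_fin /h.
by have := ukn w; rewrite ler_norml => /andP[]; lra.
Unshelve. all: by end_near.
Qed.

(** * The limit law of the rescaled distance to [Lambda] *)

Lemma cvg_in_law_eventually (R : realType) (E : ptopologicalType)
    (d : nat -> measure_display) (T : forall n, measurableType (d n))
    (P : forall n, probability (T n) R) (Z Z' : forall n, T n -> E)
    (d0 : measure_display) (T0 : measurableType d0)
    (P0 : probability T0 R) (Z0 : T0 -> E) :
    (\forall n \near \oo, forall w, Z n w = Z' n w) ->
  cvg_in_law P Z P0 Z0 -> cvg_in_law P Z' P0 Z0.
Proof.
move=> ZZ' [mZ0 cvgZ]; split=> // f cf bf.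
apply: cvg_trans (cvgZ f cf bf); apply: near_eq_cvg.
apply: filterS ZZ' => n eqZ; congr (outer_expectation _ _).
by apply/funext => w; rewrite eqZ.
Qed.

Theorem proposition4p1 (R : realType)
  (H : completeNormedModType R) (dot : {dot H for idfun})
  (hilbertH : norm_of_dot dot)
  (Lambda : set H) (closedL : closed Lambda) (convexL : convex_set Lambda)
  (* data [X n i], [i < n], on the probability space [(Omega n, P n)] *)
  (d : nat -> measure_display) (Omega : forall n, measurableType (d n))
  (P : forall n, probability (Omega n) R)
  (dS : measure_display) (S : measurableType dS)
  (X : forall n, 'I_n -> {RV (P n) >-> S})
  (theta0 : H)
  (theta_hat : forall n, ('I_n -> S) -> H)
  (r : nat -> R) (r_nondecreasing : nondecreasing_seq r)
  (r_infty : r n @[n --> \oo] --> +oo)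
  (d0 : measure_display) (Omega0 : measurableType d0)
  (P0 : probability Omega0 R) (G0 : Omega0 -> H)
  (G0_borel : borel_map G0) (G0_tight : tight_map P0 G0)
  (theta_hat_cvg : cvg_in_law P
    (fun n w => r n *: (theta_hat n (fun i => X n i w) - theta0)) P0 G0)
  (theta0L : Lambda theta0) :
  cvg_in_law P
    (fun n w => r n * `|theta_hat n (fun i => X n i w)
      - metric_proj Lambda (theta_hat n (fun i => X n i w))|)
    P0
    (fun w => `|G0 w - metric_proj (tangent_cone Lambda theta0) (G0 w)|).
Proof.
have -> : (fun w => `|G0 w - metric_proj (tangent_cone Lambda theta0) (G0 w)|)
    = set_dist (tangent_cone Lambda theta0) \o G0.
  by apply/funext => w; exact: (norm_sub_metric_proj_tangent hilbertH).
have T0 : tangent_cone Lambda theta0 !=set0 by exact: tangent_cone_neq0.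
have := @cvg_in_law_continuous_mapping _ _ R _ _ _ _ _ _ _ _
  (fun n => scaled_dist Lambda theta0 (r n)) _ theta_hat_cvg G0_tight
  (set_dist_continuous T0)
  (fun z => cvg_scaled_dist (z := z) convexL theta0L r_infty).
(* Once [r n] is positive, it cancels inside [scaled_dist], leaving [r n] times the distance from
   the estimator to [Lambda]. *)
apply: cvg_in_law_eventually; apply: filterS (cvgry_gt r_infty 0) => n rn0 w.
rewrite /scaled_dist scalerA mulVf ?gt_eqF// scale1r subrKC.
by rewrite (norm_sub_metric_proj_convex hilbertH _ convexL closedL theta0L).
Qed.
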